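(* For every real number $\alpha$ with $0<\alpha<1$ there is a constant $C(\alpha)>0$, depending only on $\alpha$, such that the following holds. Let $M$ be a real number with $M\geq 1$, let $a_1,\ldots,a_N$ be positive integers (not necessarily distinct) with $a_n\leq M$ for all $1\leq n\leq N$. For any positive integer $d$ define \[ \omega(d)=\#\{1\leq n\leq N:\ a_n\equiv 0 \ (\mathrm{mod}\ d)\}. \] Let $s$ be a positive integer. Then \[ \sum_{n=1}^{N}\left(\frac{a_n}{\varphi(a_n)}\right)^{s}\leq (C(\alpha))^{s}\left(N+\sum_{p\leq(\ln M)^{\alpha}}\frac{\omega(p)(\ln p)^{s}}{p}\right). \]
   Context: $\varphi$ is Euler's totient function; $\ln$ is the natural logarithm; $p$ denotes a prime, so the sum over $p\leq K$ is over all primes not exceeding $K$ (empty sums are $0$). $\#S$ is the number of elements of a finite set $S$. *)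

(* Defs.v *)
From mathcomp Require Import all_boot all_order all_algebra.

Set Implicit Arguments.
Unset Strict Implicit.
Unset Printing Implicit Defensive.

Definition omega (N : nat) (a : 'I_N -> nat) (d : nat) : nat :=
  #|[set n : 'I_N | d %| a n]|.

(* Main.v *)
Require Import Defs.
From mathcomp Require Import all_boot all_order all_algebra.
From mathcomp Require Import all_classical all_reals all_analysis.
From mathcomp Require Import ring lra.

Set Implicit Arguments.
Unset Strict Implicit.
Unset Printing Implicit Defensive.

Import Order.TTheory GRing.Theory Num.Theory.

(** The inequality holds term by term: it is enough to bound one
    [(a / totient a) ^+ s], and summing over the [a n] turns the sum over the
    prime divisors of each term into the weighted sum of the [omega a p].

    Since [a / totient a] is the product of [p / (p - 1)] over the primes
    dividing [a], it is at most [exp (1 + G)] with [G] the sum of [1 / p] over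
    these primes ([ratio_totient_le_expR]).  Write [y = ln M].

    The primes [p > y ^ alpha] contribute only [O(1 / alpha)] to [G]
    ([sum_inv_large_primes_le]).  For [y ^ alpha < p <= y] the inequality
    [1 <= ln p / (alpha * ln y)] reduces this to Mertens' bound
    [sum_(p <= y) ln p / p <= ln y + O(1)].  For [p > y], the sum of [ln p] over
    the prime divisors is at most [ln a <= y], while each [1 / p] is less
    than [1 / y].

    Let [g] be the contribution of the primes [p <= y ^ alpha].  If [g] is
    at most a suitable absolute constant [E], then [exp (s * g)] is absorbed in
    the constant of the theorem.  Otherwise put [u = exp (g - E)].  By Mertens' bound for [sum 1 / p], all the primes with
    [ln p <= u] together contribute at most [g - 1], so those prime divisors
    [p <= y ^ alpha] with [ln p > u] contribute at least [1], and therefore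
    [sum (ln p) ^ s / p >= u ^ s], which is [exp (s * g)] up to the factor
    [exp (s * E)] ([expR_sum_inv_primes_le]).

    Mertens' two upper bounds are obtained from Chebyshev's estimate
    [prod_(p <= n) p <= 4 ^ n] and from the power of each prime in [n!]. *)

(** * Chebyshev's bound and the prime powers in a factorial *)

Lemma dvdn_prod_primes (m n N : nat) :
  (forall p, m <= p < n -> prime p -> p %| N) ->
  \prod_(m <= p < n | prime p) p %| N.
Proof.
elim: n => [|n IHn] dvdN; first by rewrite big_geq.
have [lt_nm | le_mn] := ltnP n m; first by rewrite big_geq.
have dvd_low : \prod_(m <= p < n | prime p) p %| N.
  by apply: IHn => p /andP[lemp ltpn]; apply: dvdN; rewrite lemp ltnW.
rewrite big_mkcond big_nat_recr //= -big_mkcond /=.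
case: ifPn => [n_pr | _]; last by rewrite muln1.
rewrite Gauss_dvd; first by rewrite dvd_low dvdN // le_mn /=.
rewrite coprime_sym prime_coprime //.
rewrite Euclid_dvd_prod // big_has_cond -all_predC.
apply/allP => p; rewrite mem_index_iota => /andP[_ ltpn] /=.
apply/negP => /andP[p_pr]; rewrite dvdn_prime2 // => /eqP eqnp.
by rewrite eqnp ltnn in ltpn.
Qed.

(** The two equal middle coefficients both occur in the expansion of
    [(1 + 1) ^ (2m + 1) = 2 * 4 ^ m]. *)
Lemma bin_odd_mid_le m : 'C(m.*2.+1, m) <= 4 ^ m.
Proof.
have /= := Pascal 1 1 m.*2.+1.
have E : m.*2.+1 - m = m.+1 by rewrite -addnn -addSn addnK.
have lt1 : m < m.*2.+2 by rewrite -addnn ltnS -addnS leq_addr.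
have lt2 : m.+1 < m.*2.+2 by rewrite !ltnS -addnn leq_addr.
rewrite (bigD1 (Ordinal lt1)) //= (bigD1 (Ordinal lt2)) /=; last first.
  by rewrite -val_eqE /= -[X in _ != X]addn0 -addn1 eqn_add2l.
have -> : 'C(m.*2.+1, m.+1) = 'C(m.*2.+1, m).
  by rewrite -[X in 'C(_, X)]E bin_sub // -addnn leqW ?leq_addr.
rewrite !exp1n !muln1.
have -> : 4 ^ m = 2 ^ m.*2 by rewrite -mul2n expnM.
rewrite addnA -[1 + 1]/2 expnS => bin_sum.
by rewrite -(leq_pmul2l (isT : 0 < 2)) bin_sum mul2n -addnn leq_addr.
Qed.

(** Erdős' argument.  For [n = 2m + 1], the primes up to [m + 1] are handled by
    induction, and those in [m + 2, 2m + 1] all divide ['C(2m + 1, m) <= 4 ^ m],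
    since they divide [(2m + 1)!] but neither [m!] nor [(m + 1)!].  An even [n > 2] is not prime, so it reduces to [n - 1]. *)
Lemma primorial_le n : \prod_(0 <= p < n.+1 | prime p) p <= 4 ^ n.
Proof.
elim/ltn_ind: n => n IHn.
have [le_n2 | lt2n] := leqP n 2.
  by case: n le_n2 {IHn} => [|[|[|]]] // _; rewrite unlock.
have [n_odd | n_even] := boolP (odd n); last first.
  case: n lt2n n_even IHn => // n lt2n n_even IHn.
  rewrite big_mkcond big_nat_recr //= -big_mkcond /=.
  have /negbTE-> : ~~ prime n.+1.
    apply/negP => /even_prime[eqn2 | n_odd]; first by rewrite eqn2 in lt2n.
    by rewrite n_odd in n_even.
  by rewrite muln1 expnS (leq_trans (IHn n _)) // leq_pmull.
have [m def_n m_gt0] : exists2 m, n = m.*2.+1 & 0 < m.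
  exists n./2; first by rewrite -[LHS]odd_double_half n_odd.
  by rewrite half_gt0 ltnW.
rewrite def_n (@big_cat_nat _ _ _ m.+2) //=; last by rewrite !ltnS -addnn leq_addr.
have -> : m.*2.+1 = m.+1 + m by rewrite -addnn addSn.
rewrite expnD leq_mul //.
  by apply: IHn; rewrite def_n ltnS -addnn -addn1 leq_add2l.
have -> : m.+1 + m = m.*2.+1 by rewrite -addnn addSn.
apply: leq_trans (bin_odd_mid_le m); apply: dvdn_leq.
  by rewrite bin_gt0 -addnn leqW ?leq_addr.
apply: dvdn_prod_primes => p /andP[ltmp lepm] p_pr.
have := @bin_fact m.*2.+1 m.
have -> : m.*2.+1 - m = m.+1 by rewrite -addnn -addSn addnK.
have p_ndvd k : k < p -> ~~ (p %| k`!).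
  move=> ltkp; rewrite fact_prod Euclid_dvd_prod // big_has_cond -all_predC.
  apply/allP => i; rewrite mem_index_iota => /andP[i_gt0 leik] /=.
  by rewrite gtnNdvd // (leq_ltn_trans _ ltkp).
rewrite -{1}addnn -addnS leq_addr => /(_ isT) eq_fact.
have : p %| m.*2.+1`! by rewrite dvdn_fact // prime_gt0.
rewrite -eq_fact Euclid_dvdM // => /orP[// |].
rewrite Euclid_dvdM // => /orP[] p_dvd.
  by have := p_ndvd m (ltnW ltmp); rewrite p_dvd.
by have := p_ndvd m.+1 ltmp; rewrite p_dvd.
Qed.

(** The exponent of [p] in [n!] is at least [n %/ p], the number of multiples of
    [p] among the factors. *)
Lemma prod_prime_expn_div_le_fact n :
  \prod_(0 <= p < n.+1 | prime p) p ^ (n %/ p) <= n`!.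
Proof.
have fact_part : n`!`_(predT : nat_pred) = n`!.
  by apply: part_pnat_id; rewrite /pnat fact_gt0; apply/allP.
have le_nf : n <= n`!.
  by case: n {fact_part} => // n; rewrite factS leq_pmulr ?fact_gt0.
rewrite -[leqRHS]fact_part /partn [leqRHS](@big_cat_nat _ _ _ n.+1) //=.
rewrite -[leqLHS]muln1 leq_mul //.
  rewrite big_mkcond leq_prod // => p _; case: ifP => [p_pr | _]; last first.
    by case: p => [|p]; rewrite ?expn_gt0 // lognE.
  rewrite leq_exp2l ?prime_gt1 // logn_fact //.
  case: n {fact_part le_nf} => [|n]; first by rewrite div0n.
  by rewrite big_nat_recl // expn1 leq_addr.
by rewrite prodn_gt0 // => p; case: p => [|p]; rewrite ?expn_gt0 // lognE.
Qed.

Local Open Scope ring_scope.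

(** * Mertens' upper bounds *)

Lemma ln_prod_nat (R : realType) (I : Type) (r : seq I) (P : pred I)
    (F : I -> nat) :
  (forall i, P i -> (0 < F i)%N) ->
  ln ((\prod_(i <- r | P i) F i)%N%:R) = \sum_(i <- r | P i) ln (F i)%:R :> R.
Proof.
move=> F_gt0; suff [] : (0 < \prod_(i <- r | P i) F i)%N /\
    ln ((\prod_(i <- r | P i) F i)%N%:R) = \sum_(i <- r | P i) ln (F i)%:R :> R
  by [].
elim/big_rec2: _ => [|i x y Pi [y_gt0 <-]]; first by rewrite ln1.
split; first by rewrite muln_gt0 F_gt0.
by rewrite natrM lnM // posrE ltr0n ?F_gt0.
Qed.

Lemma ler_ln_nat (R : realType) (m n : nat) :
  (0 < m)%N -> (m <= n)%N -> ln m%:R <= ln n%:R :> R.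
Proof.
by move=> m_gt0 le_mn; rewrite ler_ln ?posrE ?ltr0n ?ler_nat // (leq_trans m_gt0).
Qed.

Lemma chebyshev_theta_le (R : realType) (n : nat) :
  \sum_(0 <= p < n.+1 | prime p) ln p%:R <= n%:R * ln 4 :> R.
Proof.
rewrite -ln_prod_nat; last exact: prime_gt0.
rewrite mulr_natl -lnXn // -natrX ler_ln_nat ?primorial_le //.
by rewrite prodn_cond_gt0 // => p; apply: prime_gt0.
Qed.

Lemma ln_fact_le (R : realType) (n : nat) : ln n`!%:R <= n%:R * ln n%:R :> R.
Proof.
case: n => [|n]; first by rewrite ln1 mul0r.
rewrite mulr_natl -lnXn // -natrX ler_ln_nat ?fact_gt0 // fact_prod.
rewrite (leq_trans (n := \prod_(1 <= i < n.+2) n.+1)) //.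
  by rewrite big_nat [leqRHS]big_nat leq_prod // => i /andP[].
by rewrite prod_nat_const_nat subSS subn0.
Qed.

(** Multiplying by [n] and rounding each [n / p] down to [n %/ p] costs
    [ln p], hence at most Chebyshev's [n * ln 4] in total; the rounded sum is the
    logarithm of a lower bound for [n!], hence at most [n * ln n]. *)
Lemma mertens_ln_sum_le (R : realType) (n : nat) : (0 < n)%N ->
  \sum_(0 <= p < n.+1 | prime p) ln p%:R / p%:R <= ln n%:R + ln 4 :> R.
Proof.
move=> n_gt0; have n_gt0R : 0 < n%:R :> R by rewrite ltr0n.
rewrite -(ler_pM2l n_gt0R) mulrDr.
have le_div : n%:R * \sum_(0 <= p < n.+1 | prime p) ln p%:R / p%:R <=
    \sum_(0 <= p < n.+1 | prime p) (ln (p ^ (n %/ p))%N%:R + ln p%:R) :> R.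
  rewrite mulr_sumr; apply: ler_sum => p p_pr.
  have p_gt0 := prime_gt0 p_pr; have p_gt0R : 0 < p%:R :> R by rewrite ltr0n.
  rewrite natrX lnXn // -mulrSr -[leRHS]mulr_natl mulrCA mulrC.
  rewrite ler_wpM2r //; first by rewrite ln_ge0 // ler1n.
  by rewrite ler_pdivrMr // -natrM ler_nat ltnW // ltn_ceil.
apply: le_trans le_div _; rewrite big_split /= lerD ?chebyshev_theta_le //.
apply: le_trans (ln_fact_le _ _); rewrite -ln_prod_nat.
  rewrite ler_ln_nat ?prod_prime_expn_div_le_fact //.
  by rewrite prodn_cond_gt0 // => p p_pr; rewrite expn_gt0 prime_gt0.
by move=> p p_pr; rewrite expn_gt0 prime_gt0.
Qed.

(** Abel summation.  With [S] and [A] the partial sums of [1 / p] and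
    [ln p / p], the difference [S n - A n / ln n] is unaffected by the arrival of
    a prime; it only grows through the change of the denominator [ln n], and
    [A n <= ln n + ln 4] bounds this growth by increments of [ln (ln n)] and of
    [- ln 4 / ln n], which telescope. *)
Lemma mertens_inv_sum_le (R : realType) (n : nat) : (1 < n)%N ->
  \sum_(0 <= p < n.+1 | prime p) p%:R^-1 <= ln (ln n%:R) + (5 - ln (ln 2)) :> R.
Proof.
have ln2_gt0 : 0 < ln 2 :> R by rewrite ln_gt0 // ltr1n.
have ln4E : ln 4 = 2 * ln 2 :> R by rewrite mulr_natl -lnXn // -natrX.
pose S k : R := \sum_(0 <= p < k.+1 | prime p) p%:R^-1.
pose A k : R := \sum_(0 <= p < k.+1 | prime p) ln p%:R / p%:R.
have lnk_gt0 k : (1 < k)%N -> 0 < ln k%:R :> R by move=> ?; rewrite ln_gt0 // ltr1n.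
have recS k : S k.+1 = S k + (if prime k.+1 then k.+1%:R^-1 else 0).
  by rewrite /S big_mkcond big_nat_recr //= -big_mkcond.
have recA k : A k.+1 = A k + (if prime k.+1 then ln k.+1%:R / k.+1%:R else 0).
  by rewrite /A big_mkcond big_nat_recr //= -big_mkcond.
have abel k : S k.+2 - A k.+2 / ln k.+2%:R <=
    ln (ln k.+2%:R) - ln (ln 2) + ln 4 * ((ln 2)^-1 - (ln k.+2%:R)^-1).
  elim: k => [|k IHk].
    rewrite !subrr mulr0 addr0 /S /A unlock /= !addr0 subr_le0 mulrAC divff ?mul1r //.
    by rewrite gt_eqF.
  set L := ln k.+2%:R in IHk *; set L' := ln k.+3%:R.
  have L_gt0 : 0 < L by rewrite lnk_gt0.
  have L'_gt0 : 0 < L' by rewrite lnk_gt0.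
  have le_LL' : L <= L' by rewrite ler_ln_nat.
  (* A new prime [q = k + 3] adds [1 / q] both to [S] and to [A / ln q]. *)
  have step : S k.+3 - A k.+3 / L' = S k.+2 - A k.+2 / L'.
    rewrite recS recA; case: ifP => _; last by rewrite !addr0.
    have : k.+3%:R != 0 :> R by rewrite pnatr_eq0.
    by rewrite -/L'; move: (k.+3%:R) => x x_neq0; field; rewrite x_neq0 gt_eqF.
  have boundA : A k.+2 * (L^-1 - L'^-1) <= (L + ln 4) * (L^-1 - L'^-1).
    rewrite ler_wpM2r ?mertens_ln_sum_le // subr_ge0.
    by rewrite lef_pV2.
  (* This is [ln x <= x - 1] at [x = L / L']. *)
  have ln_ratio : 1 - L / L' <= ln L' - ln L.
    have := @le_ln1Dx R (L / L' - 1); rewrite [1 + _]addrC subrK ln_div ?posrE //.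
    have : 0 < L / L' by rewrite divr_gt0.
    lra.
  have -> : S k.+3 - A k.+3 / L' = S k.+2 - A k.+2 / L + A k.+2 * (L^-1 - L'^-1).
    rewrite step; ring.
  have E : (L + ln 4) * (L^-1 - L'^-1) = 1 - L / L' + ln 4 * (L^-1 - L'^-1).
    by field; rewrite !gt_eqF.
  rewrite {}E in boundA; move: IHk boundA; rewrite !mulrBr; lra.
case: n => [|[|k]] // _; rewrite -/(S _).
set L := ln k.+2%:R; have L_gt0 : 0 < L by rewrite lnk_gt0.
have := abel k; rewrite -/L.
have : A k.+2 / L <= 1 + ln 4 / L.
  by rewrite ler_pdivrMr // mulrDl mul1r divfK ?gt_eqF // mertens_ln_sum_le.
rewrite mulrBr {2}ln4E mulfK ?gt_eqF //; lra.
Qed.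

(** * Sums over the prime divisors of an integer *)

Lemma sum_primes_leq (V : nmodType) (a n : nat) (F : nat -> V) : (0 < a)%N ->
  \sum_(p <- primes a | (p <= n)%N) F p =
  \sum_(0 <= p < n.+1 | prime p && (p %| a)%N) F p.
Proof.
move=> a_gt0; rewrite -big_filter -[RHS]big_filter; congr bigop.
apply: (irr_sorted_eq ltn_trans ltnn); rewrite ?sorted_filter ?sorted_primes //;
  try exact: ltn_trans; first exact: iota_ltn_sorted.
move=> p; rewrite !mem_filter mem_primes a_gt0 mem_index_iota ltnS /=.
by rewrite andbC.
Qed.

Lemma ler_sum_subpred (R : numDomainType) (I : eqType) (r : seq I) (P Q : pred I)
    (F G : I -> R) :
  (forall i, i \in r -> P i -> Q i /\ F i <= G i) ->
  (forall i, i \in r -> Q i -> 0 <= G i) ->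
  \sum_(i <- r | P i) F i <= \sum_(i <- r | Q i) G i.
Proof.
move=> PQ G_ge0; rewrite big_mkcond [leRHS]big_mkcond /= big_seq [leRHS]big_seq.
apply: ler_sum => i ri; case: ifP => [Pi | _].
  by have [-> ->] := PQ i ri Pi.
by case: ifP => // Qi; apply: G_ge0.
Qed.

Lemma sum_primes_leq_le (R : numDomainType) (a n : nat) (F : nat -> R) :
  (0 < a)%N -> (forall p, prime p -> 0 <= F p) ->
  \sum_(p <- primes a | (p <= n)%N) F p <= \sum_(0 <= p < n.+1 | prime p) F p.
Proof.
move=> a_gt0 F_ge0; rewrite sum_primes_leq //.
by apply: ler_sum_subpred => p _; [case/andP | apply: F_ge0].
Qed.

Lemma prod_primes_logn (a : nat) : (0 < a)%N ->
  (\prod_(p <- primes a) p ^ logn p a)%N = a.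
Proof. by move=> a_gt0; rewrite [RHS]prod_prime_decomp // prime_decompE big_map. Qed.

Lemma sum_primes_ln_le (R : realType) (a : nat) : (0 < a)%N ->
  \sum_(p <- primes a) ln p%:R <= ln a%:R :> R.
Proof.
move=> a_gt0; have pr_gt0 p : p \in primes a -> (0 < p)%N.
  by rewrite mem_primes => /and3P[/prime_gt0].
rewrite big_seq -ln_prod_nat // ler_ln_nat ?prodn_cond_gt0 //.
rewrite -[leqRHS]prod_primes_logn // [leqRHS]big_seq leq_prod // => p p_a.
by apply: (@leq_pexp2l p 1); rewrite ?logn_gt0 ?pr_gt0.
Qed.

Lemma ratio_totient_prod (R : numFieldType) (a : nat) : (0 < a)%N ->
  a%:R / (totient a)%:R = \prod_(p <- primes a) (p%:R / p.-1%:R) :> R.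
Proof.
move=> a_gt0; rewrite totientE // -{1}(prod_primes_logn a_gt0).
rewrite !natr_prod -prodf_div big_seq [RHS]big_seq.
apply: eq_bigr => p p_a.
have p_gt0 : (0 < p)%N by move: p_a; rewrite mem_primes => /and3P[/prime_gt0].
have : (0 < logn p a)%N by rewrite logn_gt0.
case: (logn p a) => // k _; rewrite expnS !natrM -mulf_div divff ?mulr1 //.
by rewrite pnatr_eq0 -lt0n expn_gt0 p_gt0.
Qed.

(** The condition [1 < k] discards the index 1, where [1 / (k - 1)] is the
    junk value [0^-1 = 0]; the remaining sum telescopes. *)
Lemma sum_inv_pred_sub_inv_le (R : realFieldType) (n : nat) :
  \sum_(0 <= k < n.+1 | (1 < k)%N) (k.-1%:R^-1 - k%:R^-1) <= 1 - n%:R^-1 :> R.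
Proof.
elim: n => [|n IHn]; first by rewrite unlock /= invr0 subr0 ler01.
rewrite big_mkcond big_nat_recr //= -big_mkcond /=.
case: n IHn => [|n] IHn /=; first by rewrite unlock /= invr1 addr0 subrr.
by apply: le_trans (lerD IHn (lexx _)) _; rewrite subrKA.
Qed.

(** Each factor [p / (p - 1) = 1 + 1 / (p - 1)] is at most
    [exp (1 / (p - 1))], and replacing [1 / (p - 1)] by [1 / p] costs in total at
    most the telescoping sum of [1 / (k - 1) - 1 / k], which is at most 1. *)
Lemma ratio_totient_le_expR (R : realType) (a : nat) : (0 < a)%N ->
  a%:R / (totient a)%:R <= expR (1 + \sum_(p <- primes a) p%:R^-1) :> R.
Proof.
move=> a_gt0; rewrite ratio_totient_prod //.
have pr p : p \in primes a -> prime p by rewrite mem_primes => /andP[].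
have : \prod_(p <- primes a) (p%:R / p.-1%:R) <=
    \prod_(p <- primes a) expR (p.-1%:R^-1) :> R.
  rewrite big_seq [leRHS]big_seq; apply: ler_prod => p /pr p_pr.
  rewrite divr_ge0 //= (le_trans _ (expR_ge1Dx _)) //.
  case: p p_pr => [|[|p]] // _.
  by rewrite -[p.+2%:R]natr1 mulrDl divff ?pnatr_eq0 // mul1r.
move/le_trans; apply; rewrite -expR_sum ler_expR -lerBlDr -sumrB.
(* Prime divisors of [a] are at most [a], so the sum can be cut off there. *)
have -> : \sum_(p <- primes a) (p.-1%:R^-1 - p%:R^-1) =
    \sum_(p <- primes a | (p <= a)%N) (p.-1%:R^-1 - p%:R^-1) :> R.
  rewrite big_seq [RHS]big_seq_cond; apply: eq_bigl => p.
  case: (boolP (p \in primes a)) => // ; rewrite mem_primes => /and3P[_ _ pa].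
  by rewrite dvdn_leq.
apply: le_trans (sum_primes_leq_le _ a_gt0 _) _.
  move=> p /prime_gt1; case: p => [|[|p]] // _.
  by rewrite subr_ge0 lef_pV2 ?posrE ?ltr0n // ler_nat.
apply: le_trans (le_trans (sum_inv_pred_sub_inv_le R a) _); last by rewrite gerBl.
apply: ler_sum_subpred => p _; first by move/prime_gt1.
case: p => [|[|p]] // _.
by rewrite subr_ge0 lef_pV2 ?posrE ?ltr0n // ler_nat.
Qed.

(** The primes [p > y] give the term [(ln 2)^-1], because the sum of [ln p]
    over all prime divisors is at most [ln a <= y]; those with
    [y ^ alpha < p <= y] give [3 / alpha], because [ln p > alpha * ln y]. *)
Lemma sum_inv_large_primes_le (R : realType) (alpha y : R) (a : nat) :
  0 < alpha -> (0 < a)%N -> ln a%:R <= y ->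
  \sum_(p <- primes a | y `^ alpha < p%:R) p%:R^-1 <= 3 / alpha + (ln 2)^-1.
Proof.
move=> alpha_gt0 a_gt0 le_ay.
have ln2_gt0 : 0 < ln 2 :> R by rewrite ln_gt0 // ltr1n.
have pr p : p \in primes a -> prime p by rewrite mem_primes => /andP[].
have [le_a1 | lt1a] := leqP a 1.
  have -> : a = 1%N by apply/eqP; rewrite eqn_leq le_a1.
  by rewrite big_nil addr_ge0 ?divr_ge0 ?invr_ge0 ?ltW.
have y_gt0 : 0 < y by rewrite (lt_le_trans _ le_ay) // ln_gt0 // ltr1n.
rewrite (bigID (fun p : nat => p%:R <= y)) /=; apply: lerD; last first.
  rewrite -[leRHS]mul1r ler_pdivlMr // mulr_suml.
  rewrite -(ler_pM2l y_gt0) mulr1 mulr_sumr.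
  (* Each term satisfies [y / p * ln 2 <= ln p], as [y < p] and [2 <= p]. *)
  apply: le_trans le_ay; apply: le_trans (sum_primes_ln_le _ a_gt0).
  apply: ler_sum_subpred => p /pr p_pr; last by move=> _; rewrite ln_ge0 // ler1n prime_gt0.
  rewrite -ltNge => /andP[_ lt_yp]; split=> //.
  have p_gt0 : 0 < p%:R :> R by rewrite ltr0n prime_gt0.
  rewrite mulrA (le_trans (y := ln 2)) ?ler_ln_nat ?prime_gt1 //.
  by rewrite ler_piMl ?ltW // ltr_pdivrMr // mul1r.
(* Below 2 there is no prime; from 2 on, [ln 4 <= 2 * ln y], whence the 3. *)
have [lt_y2 | le2y] := ltP y 2.
  rewrite big_seq_cond big1 ?divr_ge0 ?ltW // => p /and3P[/pr /prime_gt1 lt1p _ le_py].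
  by have := le_lt_trans le_py lt_y2; rewrite ltr_nat ltnNge lt1p.
have lny_ge : ln 2 <= ln y by rewrite ler_ln ?posrE.
have lny_gt0 : 0 < ln y by apply: lt_le_trans lny_ge.
have ln4E : ln 4 = 2 * ln 2 :> R by rewrite mulr_natl -lnXn // -natrX.
have ty_gt0 : (0 < Num.truncn y)%N by rewrite truncn_gt0 (le_trans _ le2y) // ler1n.
apply: (@le_trans _ _ (\sum_(p <- primes a | (p <= Num.truncn y)%N)
          ln p%:R / p%:R / (alpha * ln y))).
  apply: ler_sum_subpred => p /pr p_pr; last first.
    have lnp_ge0 : 0 <= ln p%:R :> R by rewrite ln_ge0 // ler1n prime_gt0.
    by move=> _; rewrite !divr_ge0 // mulr_ge0 // ltW.
  have p_gt0 : 0 < p%:R :> R by rewrite ltr0n prime_gt0.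
  move=> /andP[lt_Kp le_py]; split; first by rewrite truncn_ge_nat ?(ltW y_gt0).
  rewrite ler_pdivlMr ?mulr_gt0 // mulrC ler_wpM2r ?invr_ge0 ?ltW //.
  by rewrite -ln_powR ltr_ln ?posrE // powR_gt0.
rewrite -mulr_suml ler_pdivrMr ?mulr_gt0 // mulrA divfK ?gt_eqF //.
apply: le_trans (sum_primes_leq_le _ a_gt0 _) _.
  by move=> p p_pr; rewrite divr_ge0 // ln_ge0 // ler1n prime_gt0.
apply: le_trans (mertens_ln_sum_le _ ty_gt0) _.
have : ln (Num.truncn y)%:R <= ln y by rewrite ler_ln ?posrE ?ltr0n ?truncn_le ?ltW.
by rewrite ln4E; lra.
Qed.

(** If the left-hand side is large, then so many prime divisors are large that
    the sum of [(ln p) ^ s / p] matches it: Mertens' bound limits what the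
    primes with [ln p <= exp (g - E)] can contribute to the exponent [g], where
    [E = 6 - ln (ln 2)].  The
    constant [6] is the [5] of [mertens_inv_sum_le] plus the 1 that leaves a
    contribution of at least 1 to the larger primes. *)
Lemma expR_sum_inv_primes_le (R : realType) (a : nat) (Q : pred nat) (s : nat) :
  (0 < a)%N ->
  expR (\sum_(p <- primes a | Q p) p%:R^-1) ^+ s <=
  expR (6 - ln (ln 2)) ^+ s *
    (1 + \sum_(p <- primes a | Q p) ln p%:R ^+ s / p%:R) :> R.
Proof.
move=> a_gt0; set g := \sum_(p <- _ | _) _; set T := \sum_(p <- _ | _) _.
set E : R := 6 - _.
have pr p : p \in primes a -> prime p by rewrite mem_primes => /andP[].
have T_ge0 : 0 <= T.
  rewrite /T big_seq_cond sumr_ge0 // => p /andP[/pr p_pr _].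
  by rewrite divr_ge0 // exprn_ge0 // ln_ge0 // ler1n prime_gt0.
have [le_gE | lt_Eg] := leP g E.
  rewrite (le_trans (y := expR E ^+ s)) //.
    by rewrite lerXn2r ?nnegrE ?expR_ge0 // ler_expR.
  by rewrite ler_peMr ?exprn_ge0 ?expR_ge0 // lerDl.
(* [n] is the cutoff with [ln (ln n) <= g - E], and [p > n] forces [ln p >= u]. *)
pose u := expR (g - E); pose n := Num.truncn (expR u).
have u_gt1 : 1 < u by rewrite expR_gt1 subr_gt0.
have u_gt0 : 0 < u by apply: expR_gt0.
have n_gt1 : (1 < n)%N.
  by rewrite truncn_ge_nat ?expR_ge0 // (le_trans _ (expR_ge1Dx u)) // -natr1; lra.
have n_gt0R : 0 < n%:R :> R by rewrite ltr0n ltnW.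
have lnln_n : ln (ln n%:R) <= g - E.
  have lnn_gt0 : 0 < ln n%:R :> R by rewrite ln_gt0 // ltr1n.
  rewrite -(expRK (g - E)) ler_ln ?posrE //.
  rewrite -[leRHS]expRK ler_ln ?posrE ?expR_gt0 //.
  by rewrite truncn_le expR_ge0.
have large_ge1 : 1 <= \sum_(p <- primes a | Q p && (n < p)%N) p%:R^-1 :> R.
  have small_le : \sum_(p <- primes a | Q p && (p <= n)%N) p%:R^-1 <= g - 1.
    apply: (@le_trans _ _ (\sum_(p <- primes a | (p <= n)%N) p%:R^-1)).
      by apply: ler_sum_subpred => p _; [case/andP | rewrite invr_ge0].
    apply: le_trans (sum_primes_leq_le _ a_gt0 _) _.
      by move=> p _; rewrite invr_ge0.
    by apply: le_trans (mertens_inv_sum_le _ n_gt1) _; move: lnln_n; rewrite /E; lra.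
  have gE : g = \sum_(p <- primes a | Q p && (p <= n)%N) p%:R^-1 +
                \sum_(p <- primes a | Q p && (n < p)%N) p%:R^-1.
    rewrite /g (bigID (fun p => p <= n)%N) /=; congr (_ + _).
    by apply: eq_bigl => p; rewrite -ltnNge.
  by move: small_le gE; lra.
have T_ge : u ^+ s <= T.
  apply: (@le_trans _ _ (u ^+ s * \sum_(p <- primes a | Q p && (n < p)%N) p%:R^-1)).
    by rewrite ler_peMr // exprn_ge0 // ltW.
  rewrite mulr_sumr; apply: ler_sum_subpred => p /pr p_pr; last first.
    by rewrite divr_ge0 // exprn_ge0 // ln_ge0 // ler1n prime_gt0.
  case/andP=> Qp lt_np; split=> //; rewrite ler_wpM2r ?invr_ge0 //.
  have p_gt0 : 0 < p%:R :> R by rewrite ltr0n prime_gt0.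
  have le_up : u <= ln p%:R.
    rewrite -[leLHS]expRK ler_ln ?posrE ?expR_gt0 // ltW //.
    by rewrite -truncn_lt_nat ?expR_ge0.
  by rewrite lerXn2r ?nnegrE ?(ltW u_gt0) // (le_trans _ le_up) // ltW.
have -> : g = E + (g - E) by rewrite addrC subrK.
rewrite expRD exprMn ler_wpM2l ?exprn_ge0 ?expR_ge0 //.
by rewrite (le_trans T_ge) // lerDr.
Qed.

Lemma sum_omega (R : realType) (N : nat) (a : 'I_N -> nat) (n : nat) (F : nat -> R) :
  (forall i, (0 < a i)%N) ->
  \sum_(i < N) \sum_(p <- primes (a i) | (p <= n)%N) F p =
  \sum_(0 <= p < n.+1 | prime p) (omega a p)%:R * F p.
Proof.
move=> a_gt0.
under eq_bigr => i _ do rewrite sum_primes_leq // big_mkcondr.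
rewrite exchange_big /=; apply: eq_bigr => p _.
rewrite -big_mkcond /= sumr_const mulr_natl /omega; congr (_ *+ _).
by apply: eq_card => i; rewrite !inE.
Qed.

Theorem theorem1p1 (R : realType) (alpha : R) (halpha : 0 < alpha < 1) :
  exists2 C : R, 0 < C &
    forall (M : R) (N : nat) (a : 'I_N -> nat),
      1 <= M ->
      (forall n : 'I_N, (0 < a n)%N) ->
      (forall n : 'I_N, (a n)%:R <= M) ->
      forall s : nat, (0 < s)%N ->
        \sum_(n < N) ((a n)%:R / (totient (a n))%:R) ^+ s <=
        C ^+ s *
          (N%:R +
           \sum_(0 <= p < (Num.truncn (ln M `^ alpha)).+1 | prime p)
              (omega a p)%:R * ln p%:R ^+ s / p%:R).
Proof.
case/andP: halpha => alpha_gt0 _.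
pose D : R := 1 + (3 / alpha + (ln 2)^-1); pose E : R := 6 - ln (ln 2).
exists (expR D * expR E); first by rewrite mulr_gt0 ?expR_gt0.
move=> M N a M_ge1 a_gt0 a_leM s _; set K := Num.truncn _.
under [X in N%:R + X]eq_bigr => p _ do rewrite -mulrA.
rewrite -(@sum_omega _ _ _ _ (fun p => ln p%:R ^+ s / p%:R)) //.
have -> : N%:R = \sum_(n < N) 1 :> R by rewrite sumr_const card_ord.
rewrite -big_split /= mulr_sumr; apply: ler_sum => n _.
rewrite [(expR D * _) ^+ s]exprMn -mulrA.
have le_ratio : (a n)%:R / (totient (a n))%:R <=
    expR D * expR (\sum_(p <- primes (a n) | (p <= K)%N) p%:R^-1) :> R.
  apply: le_trans (ratio_totient_le_expR _ (a_gt0 n)) _.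
  (* The primes beyond [K] are those above [ln M `^ alpha]. *)
  rewrite -expRD ler_expR -addrA lerD2l (bigID (fun p => p <= K)%N) /= addrC.
  rewrite lerD2r; apply: le_trans (@sum_inv_large_primes_le R _ (ln M) _ _ (a_gt0 n) _) => //.
    rewrite le_eqVlt; apply/orP; left; apply/eqP; apply: eq_bigl => p.
    by rewrite -ltnNge truncn_lt_nat ?powR_ge0.
  by rewrite ler_ln ?posrE ?ltr0n ?(lt_le_trans ltr01).
apply: le_trans (_ : (expR D * expR (\sum_(p <- primes (a n) | (p <= K)%N) p%:R^-1)) ^+ s <= _).
  by rewrite lerXn2r ?nnegrE ?mulr_ge0 ?expR_ge0 // divr_ge0.
rewrite exprMn ler_wpM2l ?exprn_ge0 ?expR_ge0 //.
exact: expR_sum_inv_primes_le.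
Qed.
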